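(* Let $(X,d)$ be a pseudometric space and let $A_1,A_2$ be subsets of $X$. If the statement: (i) for all $x_1\in A_1$ and $x_2\in A_2$, there are $y_1\in A_1$ and $y_2\in A_2$ such that $d(x_1,y_2)=d(x_2,y_1)=0$ is valid, then the equality $\overline{A}_1=\overline{A}_2$ holds, where $\overline{A}_i$ denotes the closure of $A_i$ in $X$. Moreover, if $A_1$ and $A_2$ are complete subsets of $X$, then the equality $\overline{A}_1=\overline{A}_2$ implies the validity of (i).
   Context: A pseudometric on a set $X$ is a nonnegative symmetric function $d:X^2\to\mathbb R$ with $d(x,x)=0$ for every $x\in X$ that satisfies the triangle inequality; $(X,d)$ is then a pseudometric space. $X$ carries the topology having the open balls $B_r(c)=\{x\in X:d(c,x)<r\}$, $c\in X$, $r>0$, as a base. A sequence $(x_n)$ of points of $X$ converges to $a\in X$ if $d(x_n,a)\to 0$; it is a Cauchy sequence if for every $r>0$ there is $n_0\in\mathbb N$ such that $x_n\in B_r(x_{n_0})$ for every $n\ge n_0$. A subset $S\subseteq X$ is complete if for every Cauchy sequence of points of $S$ there is a point $a\in S$ to which the sequence converges.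
   Formalization: For the first implication it is assumed that A_1 and A_2 are both empty or both nonempty, since if exactly one is empty (i) holds vacuously while the closures differ; the second implication is unchanged. *)

(* Defs.v *)
From HB Require Import structures.
From mathcomp Require Import all_boot all_order all_algebra.
From mathcomp Require Import all_classical all_reals all_analysis.

Set Implicit Arguments.
Unset Strict Implicit.
Unset Printing Implicit Defensive.

Import Order.TTheory GRing.Theory Num.Theory.
Import numFieldNormedType.Exports.

Local Open Scope classical_set_scope.
Local Open Scope ring_scope.

(* The library's [pseudoMetricType] is presented by its balls and carries no
   distance function, and its [metricType] requires separation; hence a record
   for spaces given by a distance. *)
Record pseudometricSpace (R : realType) := PseudometricSpace {
  pmcarrier :> Type;
  pdist : pmcarrier -> pmcarrier -> R;
  pdist_ge0 : forall x y, 0 <= pdist x y;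
  pdistxx : forall x, pdist x x = 0;
  pdist_sym : forall x y, pdist x y = pdist y x;
  pdist_triangle : forall x y z, pdist x z <= pdist x y + pdist y z
}.

Section PseudometricTopology.
Context {R : realType} (X : pseudometricSpace R).

Definition pball (c : X) (r : R) : set X := [set x | pdist c x < r].

Lemma pball_center (x : X) (e : R) : 0 < e -> pball x e x.
Proof. by rewrite /pball /= pdistxx. Qed.

Lemma pball_sym (x y : X) (e : R) : pball x e y -> pball y e x.
Proof. by rewrite /pball /= pdist_sym. Qed.

Lemma pball_triangle (x y z : X) (e1 e2 : R) :
  pball x e1 y -> pball y e2 z -> pball x (e1 + e2) z.
Proof.
by move=> xy yz; apply: le_lt_trans (pdist_triangle x y z) _; exact: ltrD.
Qed.

HB.instance Definition _ := gen_eqMixin X.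
HB.instance Definition _ := gen_choiceMixin X.
HB.instance Definition _ := hasNbhs.Build X (nbhs_ (entourage_ pball)).
HB.instance Definition _ := @Nbhs_isPseudoMetric.Build R X
  (entourage_ pball) erefl pball pball_center pball_sym pball_triangle erefl.

Lemma pball_open (c : X) (r : R) : open (pball c r).
Proof.
rewrite openE => x cx; apply/nbhs_ballP.
exists (r - pdist c x); first by rewrite /= subr_gt0.
move=> y xy; apply: le_lt_trans (pdist_triangle c x y) _.
by rewrite -ltrBrDl.
Qed.

(* The topology derived from the balls is the one having them as a base. *)
Lemma pball_basis : basis [set B : set X | exists c r, 0 < r /\ B = pball c r].
Proof.
split; first by move=> _ [c [r [_ ->]]]; exact: pball_open.
move=> x B /nbhs_ballP[e /= e0 xB]; exists (pball x e) => //.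
by split; [exists x, e|exact: pball_center].
Qed.

Definition seq_converges (x_ : nat -> X) (a : X) : Prop :=
  (fun n => pdist (x_ n) a) @ \oo --> (0 : R).

Definition cauchy_sequence (x_ : nat -> X) : Prop :=
  forall r : R, 0 < r ->
    exists n0 : nat, forall n : nat, (n0 <= n)%N -> pball (x_ n0) r (x_ n).

Definition complete_subset (S : set X) : Prop :=
  forall x_ : nat -> X, (forall n, S (x_ n)) -> cauchy_sequence x_ ->
    exists2 a, S a & seq_converges x_ a.

End PseudometricTopology.

(* Main.v *)
(** Condition (i) says that each point of one set is at distance zero from some
    point of the other, so each set lies in the closure of the other. Conversely,
    a point in the closure of a complete set is the limit of a sequence of that
    set, which is then Cauchy, and the limit provided by completeness is at
    distance zero from the point. *)
Require Import Defs.
From mathcomp Require Import all_boot all_order all_algebra.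
From mathcomp Require Import all_classical all_reals all_analysis.

Import Order.TTheory GRing.Theory Num.Theory.

Local Open Scope classical_set_scope.
Local Open Scope ring_scope.

Lemma closure_pdistP (R : realType) (X : pseudometricSpace R) (A : set X)
    (x : X) :
  closure A x <-> forall e : R, 0 < e -> exists2 y, A y & pdist x y < e.
Proof.
split=> [clA e e0|Ax B /nbhs_ballP[e /= e0 xB]].
  have /clA[y [Ay xy]] : nbhs x (pball x e) by apply/nbhs_ballP; exists e.
  by exists y.
by have [y Ay xy] := Ax e e0; exists y; split=> //; exact: xB.
Qed.

(** By the triangle inequality, a point of [A] within [e] of [x] can be replaced by one of [B] at
    distance zero from it, still within [e] of [x]. *)
Lemma closure_subset_pdist0 (R : realType) (X : pseudometricSpace R)
    (A B : set X) :
  (forall x, A x -> exists2 y, B y & pdist x y = 0) ->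
  closure A `<=` closure B.
Proof.
move=> AB x /closure_pdistP Ax; apply/closure_pdistP => e e0.
have [y Ay xy] := Ax e e0; have [z Bz yz] := AB y Ay; exists z => //.
by apply: le_lt_trans (pdist_triangle x y z) _; rewrite yz addr0.
Qed.

Lemma complete_subset_closure (R : realType) (X : pseudometricSpace R)
    (S : set X) (x : X) :
  complete_subset S -> closure S x -> exists2 y, S y & pdist x y = 0.
Proof.
move=> Sc /closure_pdistP Sx.
have /choice[u u_spec] : forall n : nat, exists y, S y /\ pdist x y < n.+1%:R^-1.
  by move=> n; have [|y Sy xy] := Sx n.+1%:R^-1; [rewrite invr_gt0|exists y].
have uS n : S (u n) by have [] := u_spec n.
have xu e : 0 < e -> \forall n \near \oo, pdist x (u n) < e.
  move=> e0; near=> n; have [_ xun] := u_spec n; apply: lt_trans xun _.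
  by near: n; exact: near_infty_natSinv_lt (PosNum e0).
have [r r0|a Sa ua] := Sc u uS.
  (* Cauchy: from [N] on, all terms are within [r / 2] of [x], hence within [r] of [u N]. *)
  have [|N _ xuN] := xu (r / 2); first by rewrite divr_gt0.
  exists N => n Nn; rewrite [r]splitr.
  by apply: pball_triangle (xuN n Nn); apply: pball_sym; exact: xuN (leqnn N).
exists a => //; apply/eqP; rewrite eq_le pdist_ge0 andbT.
(* For each [e], one far term [u n] lies within [e / 2] of both [x] and [a]. *)
apply/ler_addgt0Pl => e e0; rewrite addr0 [e]splitr.
have e20 : 0 < e / 2 by rewrite divr_gt0.
near \oo => n; apply: le_trans (pdist_triangle x (u n) a) _.
apply: lerD; first by apply: ltW; near: n; exact: xu.
by apply: ltW; near: n; exact: cvgr_lt ua _ e20.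
Unshelve. all: by end_near. Qed.

Theorem corollary2p10 (R : realType) (X : pseudometricSpace R) (A1 A2 : set X) :
  let cond_i := forall x1 x2 : X, A1 x1 -> A2 x2 ->
    exists y1 y2 : X,
      [/\ A1 y1, A2 y2, pdist x1 y2 = 0 & pdist x2 y1 = 0] in
  (* if exactly one of A1, A2 is empty, then cond_i holds vacuously
     while the closures differ *)
  ((A1 !=set0 <-> A2 !=set0) -> cond_i -> closure A1 = closure A2) /\
  (complete_subset A1 -> complete_subset A2 ->
     closure A1 = closure A2 -> cond_i).
Proof.
move=> cond_i; split=> [A12 Ai|A1c A2c A12 x1 x2 A1x1 A2x2].
  apply/seteqP; split; apply: closure_subset_pdist0 => x Ax.
    (* Condition (i) applies only to pairs, so [x] needs some partner in [A2]. *)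
    have [x2 A2x2] : A2 !=set0 by apply/A12; exists x.
    by have [y1 [y2 [_ A2y2 xy2 _]]] := Ai x x2 Ax A2x2; exists y2.
  have [x1 A1x1] : A1 !=set0 by apply/A12; exists x.
  by have [y1 [y2 [A1y1 _ _ xy1]]] := Ai x1 x A1x1 Ax; exists y1.
(* [x1] lies in the closure of [A1], hence in that of the complete set [A2]. *)
have [y2 A2y2 xy2] : exists2 y, A2 y & pdist x1 y = 0.
  by apply: complete_subset_closure => //; rewrite -A12; exact: subset_closure.
have [y1 A1y1 xy1] : exists2 y, A1 y & pdist x2 y = 0.
  by apply: complete_subset_closure => //; rewrite A12; exact: subset_closure.
by exists y1, y2.
Qed.
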